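(* Let $d\ge 2$ and let $P$ be a plus-antipodal $d$-SMP of cardinality $2$. Let $R(n)$ be the number of $d$-dimensional permutations of length $n$ having $n$ occurrences of $P$. Then $$\log R(n)=\frac{(d-1)^2-1}{d-1}\,n\cdot\log n\,(1+o(1))$$ as $n\to\infty$.
   Context: A $d$-dimensional permutation $\Pi$ of length $n$ is an ordered $(d-1)$-tuple $(\pi^2,\dots,\pi^d)$ of permutations of $\{1,\dots,n\}$, with $\pi^i=\pi^i_1\cdots\pi^i_n$; set $\pi^1=12\cdots n$. Its elements are the $d$-tuples $\Pi_j=(\pi^1_j,\pi^2_j,\dots,\pi^d_j)^T$, $1\le j\le n$. A $d$-dimensional singleton mesh pattern ($d$-SMP) $P$ is a set of $d$-tuples in $\{+,-\}^d$; its cardinality is $|P|$. For $i\ne j$, $\mathrm{sign}(\Pi_j-\Pi_i)\in\{+,-\}^d$ denotes the tuple of componentwise signs. The element $\Pi_i$ is an occurrence of $P$ in $\Pi$ if there is no $j\neq i$ with $\mathrm{sign}(\Pi_j-\Pi_i)\in P$. For $C\in\{+,-\}^d$, $c(C)$ is obtained by replacing each $+$ by $-$ and each $-$ by $+$. $P$ is plus-antipodal if for every $C\in\{+,-\}^d$: $C\in P$ if and only if $c(C)\in P$. *)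

(* Defs.v *)
From HB Require Import structures.
From mathcomp Require Import all_boot all_order all_algebra all_fingroup.
From mathcomp Require Import all_classical all_reals all_analysis.

Set Implicit Arguments.
Unset Strict Implicit.
Unset Printing Implicit Defensive.

Section MultidimensionalPermutations.
Variables (d n : nat).

(* The tuple (pi^2, ..., pi^d), for permutations of {0, ..., n-1}; the
   convention pi^1 = id is added in [dcomponent]. *)
Definition dperm := (d.-1).-tuple 'S_n.

(* 0-based: [dcomponent Pi k] is pi^(k+1), the (k+1)-st member of
   (id, pi^2, ..., pi^d); the default value is never used when 0 < d, k < d. *)
Definition dcomponent (Pi : dperm) (k : 'I_d) : 'S_n :=
  nth 1%g (1%g :: Pi) k.

Definition delement (Pi : dperm) (j : 'I_n) : d.-tuple 'I_n :=
  [tuple dcomponent Pi k j | k < d].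

(* A sign vector in {+,-}^d: [true] is +, [false] is -. *)
Definition signs := d.-tuple bool.

(* sign (v - u), for u and v differing in every coordinate, as is the case for
   distinct elements of a d-dimensional permutation. *)
Definition sign_diff (v u : d.-tuple 'I_n) : signs :=
  [tuple (tnth u k < tnth v k)%N | k < d].

Definition SMP := {set signs}.

Definition occurrence (P : SMP) (Pi : dperm) (i : 'I_n) : bool :=
  ~~ [exists j : 'I_n,
        (j != i) && (sign_diff (delement Pi j) (delement Pi i) \in P)].

Definition num_occurrences (P : SMP) (Pi : dperm) : nat :=
  #|[set i | occurrence P Pi i]|.

End MultidimensionalPermutations.

Definition flip_signs (d : nat) (C : signs d) : signs d := map_tuple negb C.

Definition plus_antipodal (d : nat) (P : SMP d) : Prop :=
  forall C : signs d, C \in P <-> flip_signs C \in P.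

Definition num_dperm_full (d : nat) (P : SMP d) (n : nat) : nat :=
  #|[set Pi : dperm d n | num_occurrences P Pi == n]|.

(* Main.v *)
Require Import Defs.
From HB Require Import structures.
From mathcomp Require Import all_boot all_order all_algebra all_fingroup.
From mathcomp Require Import all_classical all_reals all_analysis.
From mathcomp Require Import zify ring lra.

Set Implicit Arguments.
Unset Strict Implicit.
Unset Printing Implicit Defensive.

Import Order.TTheory GRing.Theory Num.Theory.
Import numFieldNormedType.Exports.

(** A plus-antipodal pattern with two elements is [{C, -C}].  Reversing the
    coordinates in which [C] is negative turns it into the pattern of all-equal
    signs, so the permutations to be counted are those whose [n] elements form
    an antichain for the product order of [d] linear orders.  Put [m = d - 1].
    It is convenient not to normalise the first order to the identity: the set
    [antichains m n] of all families of [m + 1] linear orders on [n] labels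
    without a common ascent has [n!] times as many elements as there are
    permutations to be counted ([card_antichains_dperm]).

    Upper bound ([card_antichains_ub]).  Cut the cube of side [n] into [N^d]
    cells.  Two points in cells that are strictly comparable in all coordinates
    are comparable, so an antichain meets each diagonal line of cells at most
    once, and thus meets at most [K = (2N)^m] cells.  There are at most [N^(dK)]
    ways to choose these cells, and then every point has at most [K (n/N)^d],
    that is [O(n^d / N)], places.  If [N^m] is about [n/q] for a large constant
    [q], the first factor is [exp (O(n ln n / q))], and the second one
    contributes [(d - 1/m) n ln n + O(n)] to the logarithm.

    Lower bound ([card_antichains_lb]).  Give the labels distinct points on a
    hyperplane [x_0 + ... + x_m = mN] of the grid, which is possible once
    [n <= N^m].  Any [d] linear orders that refine the [d] coordinates of these
    points form an antichain.  The refinements of one coordinate include the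
    translates, by a sorting permutation, of the stabiliser of that coordinate
    in the symmetric group; as its orbit consists of colourings with [mN + 1]
    colours, there are at least [n! / (mN + 1)^n] of them.  Relabelling these
    families arbitrarily gives [n!] times as many.  With [N^m] about [n] the
    logarithm is again [(d - 1/m) n ln n + O(n)].

    Subtracting [ln n! = n ln n + O(n)] gives
    [d - 1/m - 1 = (m^2 - 1) / m].  For [d = 2] this constant vanishes, and a
    multiplicative error term says that the count is eventually equal to 1: of
    two linear orders without a common ascent, each is the reverse of the
    other. *)

(** * Families of linear orders forming an antichain *)

(** Counting by codes: [r x u] reads as [u] is a code of [x]; an element may
    have many codes, but a code determines the element. *)
Lemma leq_card_code (T U : finType) (A : {set T}) (r : T -> U -> bool) :
  (forall x, x \in A -> exists u, r x u) ->
  (forall x y u, r x u -> r y u -> x = y) ->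
  (#|A| <= #|U|)%N.
Proof.
move=> ex uniq_r; case: (set_0Vmem A) => [->|[x0 x0A]]; first by rewrite cards0.
have [u0 _] := ex _ x0A.
pose f x := odflt u0 [pick u | r x u].
have fr x : x \in A -> r x (f x).
  move=> xA; rewrite /f; case: pickP => //= no_u.
  by have [u] := ex _ xA; rewrite no_u.
rewrite -(card_in_imset (f := f)) ?max_card // => x y xA yA fxy.
by apply: (uniq_r _ _ (f x)); [exact: fr | rewrite fxy; exact: fr].
Qed.

(** [d = m + 1] linear orders on the labels, each given by its rank function. *)
Definition order_family (m n : nat) := {ffun 'I_m.+1 -> 'S_n}.

(** For distinct labels the non-strict inequality is strict, so this says that
    no two labels are in the same order for all [k]; writing it positively
    makes the diagonal case [i = j] harmless. *)
Definition antichains (m n : nat) : {set order_family m n} :=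
  [set s : order_family m n |
    [forall i, [forall j, [exists k, (s k j <= s k i)%N]]]].

Lemma antichainsP (m n : nat) (s : order_family m n) :
  reflect (forall i j, exists k, (s k j <= s k i)%N) (s \in antichains m n).
Proof.
rewrite inE; apply: (iffP forallP) => [h i j|h i].
  by have /forallP/(_ j)/existsP := h i.
by apply/forallP => j; apply/existsP; exact: h.
Qed.

(** * Upper bound: an antichain meets few cells *)

(** The diagonal line through a cell is determined by the differences between
    its coordinates and the first one, and two distinct cells on one diagonal
    are strictly comparable in every coordinate. *)
Lemma card_cells_antichain (m N : nat) (S : {set {ffun 'I_m.+1 -> 'I_N}}) :
  (forall x y, x \in S -> y \in S -> exists k, (y k <= x k)%N) ->
  (#|S| <= (2 * N) ^ m)%N.
Proof.
move=> hS.
(* Adding N keeps the differences nonnegative under truncated subtraction. *)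
have diag_lt (x : {ffun 'I_m.+1 -> 'I_N}) (k : 'I_m) :
    (x (lift ord0 k) + N - x ord0 < 2 * N)%N.
  by have := ltn_ord (x (lift ord0 k)); have := ltn_ord (x ord0); lia.
pose diag x := [ffun k => Ordinal (diag_lt x k)].
rewrite -[X in (_ <= _ ^ X)%N]card_ord -[X in (_ <= X ^ _)%N]card_ord -card_ffun.
rewrite -(card_in_imset (f := diag)) ?max_card //.
have diagE x y k : diag x = diag y ->
    (x (lift ord0 k) + y ord0 = y (lift ord0 k) + x ord0)%N.
  move/ffunP/(_ k)/(congr1 val); rewrite !ffunE /=.
  move: (ltn_ord (x ord0)) (ltn_ord (y ord0)).
  move: (nat_of_ord (x ord0)) (nat_of_ord (y ord0)) => u v.
  by move: (nat_of_ord (x _)) (nat_of_ord (y _)) => a b; lia.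
have diag_le x y : x \in S -> y \in S -> diag x = diag y -> (y ord0 <= x ord0)%N.
  move=> xS yS exy; have [k] := hS _ _ xS yS.
  case: (unliftP ord0 k) => [k' ->|-> //] le_k.
  by rewrite -(leq_add2l (x (lift ord0 k'))) (diagE _ _ _ exy) leq_add2r.
move=> x y xS yS exy.
have e0 : x ord0 = y ord0 :> nat.
  by apply/eqP; rewrite eqn_leq !diag_le.
apply/ffunP => k; apply: val_inj.
case: (unliftP ord0 k) => [k' ->|-> //].
by have := diagE _ _ k' exy; rewrite e0 => /addIn.
Qed.

Lemma set_enumerated (T : finType) (S : {set T}) (K : nat) :
  (0 < #|T|)%N -> (#|S| <= K)%N ->
  exists f : {ffun 'I_K -> T}, forall x, x \in S -> exists i, f i = x.
Proof.
move=> /card_gt0P[x0 _] leSK; exists [ffun i : 'I_K => nth x0 (enum S) i] => x xS.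
have lt_x : (index x (enum S) < K)%N.
  by apply: leq_trans leSK; rewrite cardE index_mem mem_enum.
by exists (Ordinal lt_x); rewrite ffunE /= nth_index // mem_enum.
Qed.

(** A code of a family lists, with repetitions, the cells that its points
    occupy; it then gives for each label the rank of its cell in the list and
    the position of its point inside this cell. *)
Lemma card_antichains_ub (m n N b : nat) : (0 < n)%N -> (n <= N * b)%N ->
  (#|antichains m n| <=
     N ^ (m.+1 * (2 * N) ^ m) * ((2 * N) ^ m * b ^ m.+1) ^ n)%N.
Proof.
move=> n_gt0 le_n_Nb.
have /andP[N_gt0 b_gt0] : (0 < N)%N && (0 < b)%N by rewrite -muln_gt0; lia.
set K := ((2 * N) ^ m)%N.
have cell_lt (x : 'I_n) : (x %/ b < N)%N.
  by rewrite ltn_divLR //; apply: leq_trans le_n_Nb.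
have res_lt (x : 'I_n) : (x %% b < b)%N by rewrite ltn_mod.
pose cell (s : order_family m n) i := [ffun k => Ordinal (cell_lt (s k i))].
pose U := ({ffun 'I_K -> {ffun 'I_m.+1 -> 'I_N}} *
           {ffun 'I_n -> 'I_K * {ffun 'I_m.+1 -> 'I_b}})%type.
pose r (s : order_family m n) (u : U) := [forall k, forall i,
  s k i == (u.1 (u.2 i).1 k * b + (u.2 i).2 k)%N :> nat].
have cardU : #|{: U}| = (N ^ (m.+1 * K) * (K * b ^ m.+1) ^ n)%N.
  by rewrite card_prod !card_ffun card_prod card_ffun !card_ord expnM.
rewrite -cardU; apply: (@leq_card_code _ _ _ r) => [s /antichainsP s_anti|s t u].
  have leK : (#|[set cell s i | i in 'I_n]| <= K)%N.
    apply: card_cells_antichain => _ _ /imsetP[i _ ->] /imsetP[j _ ->].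
    by have [k le_k] := s_anti i j; exists k; rewrite !ffunE /= leq_div2r.
  have [|f fP] := set_enumerated _ leK.
    by rewrite card_ffun !card_ord expn_gt0 N_gt0.
  have /fin_all_exists[g gP] i : exists c, f c = cell s i by apply/fP/imset_f.
  exists (f, [ffun i => (g i, [ffun k => Ordinal (res_lt (s k i))])]).
  apply/forallP => k; apply/forallP => i.
  by rewrite /= !ffunE /= gP !ffunE /= -divn_eq.
move=> /forallP rs /forallP rt; apply/ffunP => k; apply/permP => i; apply: val_inj.
exact: etrans (eqP (forallP (rs k) i)) (esym (eqP (forallP (rt k) i))).
Qed.

(** * Two linear orders *)

Lemma perm_eq_order (n : nat) (u v : 'S_n) :
  (forall i j, (u i < u j)%N = (v i < v j)%N) -> u = v.
Proof.
have rankE (w : 'S_n) i : w i = #|[set j | (w j < w i)%N]| :> nat.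
  rewrite -(card_imset _ (@perm_inj _ w)).
  rewrite (_ : w @: _ = [set x : 'I_n | (x < w i)%N]).
    rewrite -sum1dep_card -[LHS]card_ord -[LHS]sum1_card.
    by rewrite (big_ord_widen n (fun=> 1%N)) // ltnW.
  apply/setP => x; rewrite inE; apply/imsetP/idP => [[j]|lt_x].
    by rewrite inE => ? ->.
  by exists ((w^-1)%g x); rewrite ?inE permKV.
move=> uv; apply/permP => i; apply: val_inj; rewrite [LHS]rankE [RHS]rankE.
by apply: eq_card => j; rewrite !inE uv.
Qed.

Lemma card_antichains_dim2 (n : nat) : (#|antichains 1 n| <= n`!)%N.
Proof.
rewrite -card_Sn -(card_in_imset (f := fun s : order_family 1 n => s ord0)).
  exact: max_card.
have rev (s : order_family 1 n) : s \in antichains 1 n ->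
    forall i j, (s ord_max i < s ord_max j)%N = (s ord0 j < s ord0 i)%N.
  move=> /antichainsP s_anti i j; case: (eqVneq i j) => [->|neq_ij].
    by rewrite !ltnn.
  have neq (k : 'I_2) : s k i != s k j :> nat by rewrite val_eqE (inj_eq perm_inj).
  have := neq ord0; have := neq ord_max.
  have [k1] := s_anti i j; have [k2] := s_anti j i.
  have ord2 (k : 'I_2) : k = ord0 \/ k = ord_max.
    by case: k => -[|[|//]] ?; [left|right]; apply: val_inj.
  case: (ord2 k1) => ->; case: (ord2 k2) => ->; lia.
move=> s t sA tA e0; apply/ffunP => k.
have eM : s ord_max = t ord_max.
  by apply: perm_eq_order => i j; rewrite !rev // e0.
by case: k => -[|[|//]] k_lt;
  [rewrite (_ : Ordinal _ = ord0) //|rewrite (_ : Ordinal _ = ord_max) //];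
  apply: val_inj.
Qed.

(** * Lower bound: orders refining the coordinates of points on a hyperplane *)

Lemma sorting_perm (n L : nat) (c : 'I_n -> 'I_L) :
  exists p : 'S_n, forall i j, (c i < c j)%N -> (p i < p j)%N.
Proof.
pose t := [tuple val (c i) | i < n].
have /tuple_permP[p tp] : perm_eq (sort_tuple leq t) t by rewrite perm_sort.
exists (p^-1)%g => i j lt_c; rewrite ltnNge; apply/negP => le_p.
have : (nth 0%N (sort_tuple leq t) ((p^-1)%g j) <=
        nth 0%N (sort_tuple leq t) ((p^-1)%g i))%N.
  apply: (sorted_leq_nth leq_trans leqnn) => //.
  - exact/sort_sorted/leq_total.
  - by rewrite inE size_sort size_tuple.
  - by rewrite inE size_sort size_tuple.
have nthE (x : 'I_n) : nth 0%N (sort_tuple leq t) x = c (p x).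
  by rewrite tp -tnth_nth !tnth_mktuple.
by rewrite !nthE !permKV leqNgt lt_c.
Qed.

(** Orbit counting for the action of the symmetric group on colourings: two
    permutations that take [c] to the same colouring differ by an element of
    the stabiliser of [c], and there are at most [L ^ n] colourings. *)
Lemma card_colour_stab (n L : nat) (c : 'I_n -> 'I_L) :
  (n`! <= #|[set s : 'S_n | [forall i, c (s i) == c i]]| * L ^ n)%N.
Proof.
set St := [set s | _].
rewrite -card_Sn -[X in (X <= _)%N]sum1_card.
pose col (s : 'S_n) := [ffun i => c (s i)].
rewrite (partition_big col xpredT) //=.
rewrite [X in (_ <= X)%N](_ : _ = \sum_(h : {ffun 'I_n -> 'I_L}) #|St|)%N; last first.
  by rewrite sum_nat_const card_ffun !card_ord mulnC.
apply: leq_sum => h _; rewrite sum1dep_card.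
have [->|[s0]] := set_0Vmem [set s | col s == h]; first by rewrite cards0.
rewrite inE => /eqP s0h.
rewrite -(card_imset _ (mulgI (s0^-1)%g)); apply/subset_leq_card.
apply/fintype.subsetP => _ /imsetP[s sh ->]; rewrite inE; apply/forallP => i.
move: sh; rewrite inE -s0h => /eqP/ffunP/(_ ((s0^-1)%g i)).
by rewrite !ffunE permM permKV => ->.
Qed.

(** The families are [g * s_k * p_k], with [p_k] sorting the [k]-th coordinate,
    [s_k] in its stabiliser, and [g] an arbitrary relabelling.  No information
    is lost: the family determines the point of each relabelled label, hence
    [g], because the points are distinct. *)
Lemma card_antichains_lb (m n N : nat) : (n <= N ^ m)%N ->
  (n`! ^ m.+2 <= #|antichains m n| * (m * N).+1 ^ (n * m.+1))%N.
Proof.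
move=> le_n.
have [a a_inj] : exists a : 'I_n -> {ffun 'I_m -> 'I_N}, injective a.
  have le_n' : (n <= #|{: {ffun 'I_m -> 'I_N}}|)%N by rewrite card_ffun !card_ord.
  exists (fun i => enum_val (widen_ord le_n' i)).
  by move=> i j /enum_val_inj/(congr1 val) /= /val_inj.
(* Coordinate 0 is the one that puts the point on the hyperplane. *)
pose lev i (k : 'I_m.+1) : nat := if unlift ord0 k is Some k' then a i k'
  else (m * N - \sum_k' a i k')%N.
have sum_le i : (\sum_k' a i k' <= m * N)%N.
  rewrite -[X in (_ <= X * _)%N]card_ord -sum_nat_const.
  by apply: leq_sum => k' _; exact: ltnW.
have lev_lt i k : (lev i k < (m * N).+1)%N.
  rewrite /lev; case: unliftP => [k' _|_]; last by rewrite ltnS leq_subr.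
  apply: leq_trans (ltn_ord _) _; case: (m) k' => [[]//|m' _].
  by rewrite mulSn; apply: leq_trans (leq_addr _ _) _.
pose c k i := Ordinal (lev_lt i k).
have sum_c i : (\sum_k c k i = m * N)%N.
  rewrite big_ord_recl /= /lev unlift_none.
  rewrite [X in (_ + X)%N](eq_bigr (fun k' => a i k' : nat)) ?subnK // => k' _.
  by rewrite liftK.
have c_inj x y : (forall k, c k x = c k y :> nat) -> x = y.
  move=> cxy; apply: a_inj; apply/ffunP => k; apply: val_inj.
  by have := cxy (lift ord0 k); rewrite /= /lev liftK.
(* Equal sums: if one point is nowhere above the other, they coincide. *)
have c_drop x y : x != y -> exists k, (c k y < c k x)%N.
  move=> neq_xy; apply/existsP; rewrite -[X in is_true X]negbK negb_exists.
  apply/negP => /forallP le_c; case/eqP: neq_xy; apply: c_inj => k.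
  have le_c' k' : (c k' x <= c k' y)%N by rewrite leqNgt.
  have /eqP : (\sum_k' c k' x = \sum_k' c k' y)%N by rewrite !sum_c.
  rewrite (leqif_sum (fun k' _ => leqif_eq (le_c' k'))).2.
  by move=> /forallP/(_ k)/eqP.
have /fin_all_exists[p pP] k := sorting_perm (c k).
pose St k := [set s : 'S_n | [forall i, c k (s i) == c k i]].
pose F (gs : 'S_n * {ffun 'I_m.+1 -> 'S_n}) : order_family m n :=
  [ffun k => (gs.1 * gs.2 k * p k)%g].
pose D := finset.setX [set: 'S_n] [set s : {ffun 'I_m.+1 -> 'S_n} | s \in family St].
have cSt k s i : s \in St k -> c k (s i) = c k i.
  by rewrite inE => /forallP/(_ i)/eqP.
have F_anti gs : gs \in D -> F gs \in antichains m n.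
  case: gs => g s gsD; apply/antichainsP => i j; move: gsD.
  rewrite !inE /= => /familyP sSt.
  case: (eqVneq i j) => [->|neq_ij]; first by exists ord0.
  have [|k lt_k] := @c_drop (g i) (g j); first by rewrite (inj_eq perm_inj).
  exists k; rewrite !ffunE !permM /=; apply/ltnW/pP.
  by rewrite !(cSt _ _ _ (sSt k)).
have F_inj : {in D &, injective F}.
  move=> [g s] [g' s']; rewrite !inE /= => /familyP sSt /familyP s'St eF.
  have eF' k i : s k (g i) = s' k (g' i).
    move/ffunP/(_ k)/permP/(_ i): eF.
    by rewrite !ffunE !permM /= => /perm_inj.
  have eg : g = g'.
    apply/permP => i; apply: c_inj => k.
    by rewrite -(cSt _ _ (g i) (sSt k)) -(cSt _ _ (g' i) (s'St k)) eF'.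
  rewrite {1}eg; congr (_, _); apply/ffunP => k; apply/permP => i.
  by have := eF' k ((g^-1)%g i); rewrite -eg permKV.
have cardD : (#|D| <= #|antichains m n|)%N.
  rewrite -(card_in_imset F_inj); apply/subset_leq_card/fintype.subsetP.
  by move=> _ /imsetP[gs gsD ->]; exact: F_anti.
apply: leq_trans (leq_mul cardD (leqnn _)).
rewrite cardsX cardsT card_Sn cardsE card_family expnS -mulnA leq_mul2l.
apply/orP; right.
rewrite foldrE big_map big_enum /= expnM -[X in (_ <= _ * _ ^ X)%N]card_ord.
rewrite -[X in (_ ^ X <= _)%N]card_ord -!prod_nat_const -big_split /=.
apply: leq_prod => k _; exact: card_colour_stab.
Qed.

(** * From mesh patterns to antichains *)

Lemma plus_antipodal_pair (m : nat) (P : SMP m.+1) :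
  plus_antipodal P -> #|P| = 2%N -> exists C, P = [set C; flip_signs C].
Proof.
move=> P_anti cardP; have /card_gt0P[C CP] : (0 < #|P|)%N by rewrite cardP.
exists C; apply/eqP; rewrite eq_sym eqEcard cardP cards2.
have -> : C != flip_signs C.
  apply/eqP => /(congr1 (fun D => tnth D ord0)).
  by rewrite tnth_map; case: (tnth C ord0).
rewrite andbT; apply/fintype.subsetP => D; rewrite !inE => /orP[]/eqP -> //.
exact: (P_anti C).1.
Qed.

Lemma num_occurrences_full (d n : nat) (P : SMP d) (Pi : dperm d n) :
  reflect (forall i j, j != i ->
             sign_diff (delement Pi j) (delement Pi i) \notin P)
          (num_occurrences P Pi == n).
Proof.
rewrite /num_occurrences.
have -> : (#|[set i | occurrence P Pi i]| == n) = [forall i, occurrence P Pi i].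
  rewrite -[X in _ == X]card_ord -cardsT eqn_leq subset_leq_card ?finset.subsetT //=.
  apply/idP/forallP => [le_card i|occ].
    have : i \in [set i | occurrence P Pi i].
      rewrite (_ : [set i | _] = [set: _]) ?inE //; apply/eqP.
      by rewrite eqEcard finset.subsetT.
    by rewrite inE.
  by apply/subset_leq_card/fintype.subsetP => i _; rewrite inE.
apply: (iffP forallP) => [occ i j neq_ji|notP i].
  by have := occ i; rewrite /occurrence negb_exists => /forallP/(_ j); rewrite neq_ji.
rewrite /occurrence negb_exists; apply/forallP => j; rewrite negb_and.
by case: (eqVneq j i) => //= neq_ji; exact: notP.
Qed.

Lemma ltn_rev_perm (n : nat) :
  exists rho : 'S_n, forall i j, (rho i < rho j)%N = (j < i)%N.
Proof.
exists (perm rev_ord_inj) => i j; rewrite !permE /=.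
by have := ltn_ord i; have := ltn_ord j; lia.
Qed.

(** A family is recovered from its first order and the other orders expressed
    relative to it.  Composing the [k]-th order with the reversal [rho k]
    whenever [C] is negative at [k] turns an occurrence of the sign vector [C]
    into a common ascent, and one of [- C] into a common descent. *)
Lemma card_antichains_dperm (m n : nat) (P : SMP m.+1) :
  plus_antipodal P -> #|P| = 2%N ->
  (#|antichains m n| = n`! * num_dperm_full P n)%N.
Proof.
move=> P_anti cardP; have [C defP] := plus_antipodal_pair P_anti cardP.
have [rev ltn_rev] := ltn_rev_perm n.
pose rho k : 'S_n := if tnth C k then 1%g else rev.
have ltn_rho k (x y : 'I_n) : x != y ->
    (rho k x < rho k y)%N = ((x < y)%N == tnth C k).
  rewrite -val_eqE /= /rho; case: (tnth C k) => neq_xy; rewrite ?perm1 ?ltn_rev.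
    by rewrite eqb_id.
  by move: neq_xy; case: (ssrnat.ltngtP x y).
pose F (gP : 'S_n * dperm m.+1 n) : order_family m n :=
  [ffun k => (gP.1 * dcomponent gP.2 k * rho k)%g].
have signE (Pi : dperm m.+1 n) i j : i != j ->
    (sign_diff (delement Pi j) (delement Pi i) == C) =
    [forall k, (rho k (dcomponent Pi k i) < rho k (dcomponent Pi k j))%N].
  move=> neq_ij; have comp_neq k : dcomponent Pi k i != dcomponent Pi k j.
    by rewrite (inj_eq perm_inj).
  apply/eqP/forallP => [eC k|ltC].
    by rewrite ltn_rho // -eC !tnth_mktuple.
  apply: eq_from_tnth => k; apply/eqP.
  by rewrite !tnth_mktuple -ltn_rho.
have flipE (Pi : dperm m.+1 n) i j : i != j ->
    (sign_diff (delement Pi j) (delement Pi i) == flip_signs C) =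
    (sign_diff (delement Pi i) (delement Pi j) == C).
  move=> neq_ij; have comp_neq k : dcomponent Pi k i != dcomponent Pi k j :> nat.
    by rewrite val_eqE (inj_eq perm_inj).
  have flip_tnth k : tnth (flip_signs C) k = ~~ tnth C k by rewrite tnth_map.
  apply/eqP/eqP => eC; apply: eq_from_tnth => k;
    move/(congr1 (fun D => tnth D k)): eC; have := comp_neq k;
    rewrite flip_tnth !tnth_mktuple;
    by case: (ssrnat.ltngtP (dcomponent Pi k i)); case: (tnth C k).
have F_anti gP : (F gP \in antichains m n) = (num_occurrences P gP.2 == n).
  case: gP => g Pi; apply/antichainsP/num_occurrences_full => /= [anti|full].
    have notC i j : i != j -> sign_diff (delement Pi j) (delement Pi i) != C.
      move=> neq_ij; rewrite signE // negb_forall.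
      have [k] := anti ((g^-1)%g i) ((g^-1)%g j).
      rewrite !ffunE !permM !permKV => le_k.
      by apply/existsP; exists k; rewrite -leqNgt.
    move=> i j neq_ji; rewrite defP !inE negb_or flipE ?[i == j]eq_sym //.
    by rewrite !notC // eq_sym.
  move=> i j; case: (eqVneq i j) => [->|neq_ij]; first by exists ord0.
  have neq_g : g i != g j by rewrite (inj_eq perm_inj).
  have := full (g i) (g j); rewrite eq_sym neq_g defP !inE signE // => /(_ isT).
  rewrite negb_or negb_forall => /andP[/existsP[k]].
  by rewrite -leqNgt => le_k _; exists k; rewrite !ffunE !permM.
have compS (Pi : dperm m.+1 n) (k : 'I_m) :
    dcomponent Pi (lift ord0 k) = tnth Pi k.
  by rewrite /dcomponent [RHS](tnth_nth 1%g).
have F_inj : injective F.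
  move=> [g Pi] [h Sg] /ffunP eF.
  have eg : g = h.
    have := eF ord0; rewrite !ffunE /= => /mulIg.
    by rewrite /dcomponent /= !mulg1.
  suff -> : Pi = Sg by rewrite eg.
  apply: eq_from_tnth => k.
  have := eF (lift ord0 k); rewrite !ffunE /= eg => /mulIg/mulgI.
  by rewrite !compS.
rewrite -card_Sn -cardsT -cardsX -(card_imset _ F_inj); congr #|pred_of_set _|.
apply/setP => s; apply/idP/imsetP => [s_anti|[gP]]; last first.
  by move=> gP_full ->; rewrite F_anti; move: gP_full; rewrite !inE.
pose g : 'S_n := (s ord0 * (rho ord0)^-1)%g.
pose Pi : dperm m.+1 n :=
  [tuple (g^-1 * s (lift ord0 k) * (rho (lift ord0 k))^-1)%g | k < m].
have sE : s = F (g, Pi).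
  apply/ffunP => k; rewrite ffunE /=; case: (unliftP ord0 k) => [k' ->|->].
    rewrite compS tnth_mktuple !mulgA mulgV mul1g.
    by rewrite -mulgA mulVg mulg1.
  by rewrite /dcomponent /= mulg1 -mulgA mulVg mulg1.
exists (g, Pi); rewrite // finset.in_setX finset.in_setT inE /=.
by rewrite -[Pi]/((g, Pi).2) -F_anti -sE.
Qed.

(** * Choice of the grid *)

(** [n ^ n <= (2n) ... (n + 1) = n! 'C(2n, n)]. *)
Lemma expnn_le_fact (n : nat) : (n ^ n <= n`! * 4 ^ n)%N.
Proof.
have bin_le : ('C(n + n, n) <= 4 ^ n)%N.
  rewrite (_ : 4 ^ n = (1 + 1) ^ (n + n))%N; last by rewrite (addnn n) -mul2n expnM.
  have lt_n : (n < (n + n).+1)%N by rewrite ltnS leq_addr.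
  by rewrite expnDn (bigD1 (Ordinal lt_n)) //= !exp1n !muln1 leq_addr.
apply: leq_trans (leq_mul (leqnn _) bin_le).
rewrite mulnC bin_ffact ffact_prod -[X in (_ ^ X <= _)%N]card_ord -prod_nat_const.
by apply: leq_prod => i _; have := ltn_ord i; lia.
Qed.

(** Take the least [N] with [n <= N ^ m], so that [N <= 2 (N - 1)] and
    [(N - 1) ^ m < n]. *)
Lemma antichains_lb_nat (m n : nat) : (0 < m)%N -> (1 < n)%N ->
  exists2 L, (n`! ^ m.+2 <= #|antichains m n| * L ^ (n * m.+1))%N &
             (0 < L)%N && (L ^ m <= (4 * m) ^ m * n)%N.
Proof.
move=> m_gt0 n_gt1.
have exN : exists N, (n <= N ^ m)%N.
  by exists n; rewrite -{1}[n]expn1 leq_pexp2l // ltnW.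
case: (ex_minnP exN) => N le_n minN; exists (m * N).+1.
  exact: card_antichains_lb.
have N_gt1 : (1 < N)%N.
  rewrite ltnNge; apply/negP => N_le1; have : (N ^ m <= 1)%N.
    by rewrite -(exp1n m) leq_exp2r.
  by rewrite leqNgt (leq_trans n_gt1 le_n).
have lt_n : (N.-1 ^ m < n)%N.
  by rewrite ltnNge; apply/negP => /minN; lia.
apply: leq_trans (leq_mul (leqnn _) (ltnW lt_n)).
rewrite -expnMn leq_exp2r //; nia.
Qed.

(** Take the largest [N] with [N ^ m * q <= n].  The parameter [q] makes the
    number [(2N) ^ m] of occupied cells a small fraction of [n]. *)
Lemma antichains_ub_nat (m n q : nat) : (0 < m)%N -> (0 < q <= n)%N ->
  exists N, [/\ (0 < N <= n)%N, (q * (2 * N) ^ m <= 2 ^ m * n)%N,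
    (n <= (2 * N) ^ m * q)%N &
    (#|antichains m n| * N ^ n <=
      N ^ (m.+1 * (2 * N) ^ m) * (4 * n) ^ (m.+1 * n))%N].
Proof.
move=> m_gt0 /andP[q_gt0 le_qn].
have exN : exists N, (N ^ m * q <= n)%N by exists 1%N; rewrite exp1n mul1n.
have bnd N : (N ^ m * q <= n)%N -> (N <= n)%N.
  case: N => // N le_n; apply: leq_trans le_n.
  apply: leq_trans (leq_pmulr _ q_gt0).
  by rewrite -{1}[N.+1]expn1 leq_pexp2l.
case: (ex_maxnP exN bnd) => N le_n maxN.
have N_gt0 : (0 < N)%N by apply: maxN; rewrite exp1n mul1n.
exists N; split; first by rewrite N_gt0 bnd.
- by rewrite expnMn mulnCA leq_mul2l mulnC le_n orbT.
- have : (n < N.+1 ^ m * q)%N by rewrite ltnNge; apply/negP => /maxN; rewrite ltnn.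
  move/ltnW/leq_trans; apply; rewrite leq_mul2r leq_exp2r //; apply/orP; right.
  by lia.
set b := (n %/ N).+1.
have le_nNb : (n <= N * b)%N by rewrite mulnC; apply/ltnW; rewrite ltn_ceil.
have le_Nb : (N * b <= 2 * n)%N.
  have := bnd _ le_n; have := leq_trunc_div n N; rewrite /b mulnS [(n %/ N * N)%N]mulnC.
  by lia.
have n_gt0 : (0 < n)%N by apply: leq_trans le_qn.
have le_base : ((2 * N) ^ m * b ^ m.+1 * N <= (4 * n) ^ m.+1)%N.
  have -> : ((2 * N) ^ m * b ^ m.+1 * N = 2 ^ m * (N * b) ^ m.+1)%N.
    by rewrite !expnMn !expnS; lia.
  apply: (@leq_trans (2 ^ m.+1 * (2 * n) ^ m.+1)%N).
    by apply: leq_mul; rewrite ?leq_exp2r ?leq_exp2l.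
  by rewrite -expnMn mulnA.
apply: (@leq_trans (N ^ (m.+1 * (2 * N) ^ m) *
                    ((2 * N) ^ m * b ^ m.+1) ^ n * N ^ n)%N).
  by rewrite leq_mul2r card_antichains_ub ?orbT.
by rewrite -mulnA -expnMn [((4 * n) ^ _)%N]expnM leq_mul2l leq_exp2r // le_base orbT.
Qed.

(** * Asymptotics *)

Local Open Scope classical_set_scope.
Local Open Scope ring_scope.

Lemma lnX_nat (R : realType) (a k : nat) : (0 < a)%N ->
  ln ((a ^ k)%:R : R) = k%:R * ln (a%:R : R).
Proof. by move=> a_gt0; rewrite natrX lnXn ?ltr0n // mulr_natl. Qed.

Lemma lnM_nat (R : realType) (a b : nat) : (0 < a)%N -> (0 < b)%N ->
  ln ((a * b)%:R : R) = ln (a%:R : R) + ln (b%:R : R).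
Proof. by move=> a_gt0 b_gt0; rewrite natrM lnM // posrE ltr0n. Qed.

Lemma ler_ln_nat (R : realType) (a b : nat) : (0 < a)%N -> (a <= b)%N ->
  ln (a%:R : R) <= ln (b%:R : R).
Proof.
by move=> a_gt0 le_ab; rewrite ler_ln ?ler_nat // posrE ltr0n // (leq_trans a_gt0).
Qed.

Lemma ln_fact_ge (R : realType) (n : nat) : (0 < n)%N ->
  n%:R * ln (n%:R : R) - n%:R * ln (4 : R) <= ln (n`!%:R : R).
Proof.
move=> n_gt0; have := @ler_ln_nat R _ _ _ (expnn_le_fact n).
rewrite lnM_nat ?fact_gt0 ?expn_gt0 ?n_gt0 // !lnX_nat //.
by move=> /(_ isT); rewrite lerBlDr.
Qed.

Section Estimates.
Variables (R : realType) (m : nat) (P : SMP m.+1).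
Hypotheses (m_gt0 : (0 < m)%N) (P_anti : plus_antipodal P) (cardP : #|P| = 2%N).

Lemma num_dperm_full_lb (n : nat) : (1 < n)%N ->
  exists2 L, (n`! ^ m.+1 <= num_dperm_full P n * L ^ (n * m.+1))%N &
             (0 < L)%N && (L ^ m <= (4 * m) ^ m * n)%N.
Proof.
move=> n_gt1; have [L le_A bndL] := antichains_lb_nat m_gt0 n_gt1.
exists L => //; move: le_A.
by rewrite (card_antichains_dperm _ P_anti cardP) expnS -mulnA leq_pmul2l ?fact_gt0.
Qed.

Lemma num_dperm_full_gt0 (n : nat) : (1 < n)%N -> (0 < num_dperm_full P n)%N.
Proof.
move=> /num_dperm_full_lb[L le_r _]; have : (0 < n`! ^ m.+1)%N.
  by rewrite expn_gt0 fact_gt0.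
by move/leq_trans/(_ le_r); rewrite muln_gt0 => /andP[].
Qed.

(** Both estimates are multiplied by [m] to avoid the [m]-th root in the choice
    of the grid. *)
Lemma ln_num_dperm_full_ge : exists B : R, forall n, (1 < n)%N ->
  (m%:R ^+ 2 - 1) * (n%:R * ln n%:R) - B * n%:R <=
    m%:R * ln (num_dperm_full P n)%:R.
Proof.
exists (m.+1%:R * m%:R * (ln 4 + ln (4 * m)%:R)) => n n_gt1.
have n_gt0 := ltnW n_gt1.
have r_gt0 := num_dperm_full_gt0 n_gt1.
have [L le_r /andP[L_gt0 le_L]] := num_dperm_full_lb n_gt1.
have := @ler_ln_nat R _ _ _ le_r; rewrite expn_gt0 fact_gt0 => /(_ isT).
rewrite lnM_nat ?expn_gt0 ?L_gt0 // !lnX_nat ?fact_gt0 //.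
have := @ler_ln_nat R _ _ _ le_L; rewrite expn_gt0 L_gt0 => /(_ isT).
rewrite lnM_nat ?expn_gt0 ?muln_gt0 ?m_gt0 // !lnX_nat ?muln_gt0 ?m_gt0 //.
have := ln_fact_ge R n_gt0.
rewrite [(n * m.+1)%:R]natrM -![m.+1%:R]natr1.
move: (ln n`!%:R) (ln L%:R) (ln (num_dperm_full P n)%:R) (ln n%:R) => f l r x.
move: (ln (4 : R)) (ln ((4 * m)%:R : R)) => c4 c4m.
have : 0 <= n%:R :> R by [].
have : 0 <= m%:R :> R by [].
move: (n%:R : R) (m%:R : R) => y u u_ge0 y_ge0 f_ge l_le r_ge.
(* The claim is the sum of the three estimates with these multipliers. *)
have h1 : 0 <= (u * (u + 1)) * (f - (y * x - y * c4)).
  by apply: mulr_ge0; [apply: mulr_ge0; rewrite ?addr_ge0|rewrite subr_ge0].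
have h2 : 0 <= (y * (u + 1)) * (u * c4m + x - u * l).
  by apply: mulr_ge0; [apply: mulr_ge0; rewrite ?addr_ge0|rewrite subr_ge0].
have h3 : 0 <= u * (r + y * (u + 1) * l - (u + 1) * f).
  by apply: mulr_ge0; rewrite ?subr_ge0.
by lra.
Qed.

Lemma ln_num_dperm_full_le (q : nat) : (0 < q)%N ->
  exists B : R, forall n, (1 < n)%N -> (q <= n)%N ->
  m%:R * ln (num_dperm_full P n)%:R <=
    (m%:R ^+ 2 - 1 + m%:R * m.+1%:R * 2 ^+ m / q%:R) * (n%:R * ln n%:R) + B * n%:R.
Proof.
move=> q_gt0; exists (m%:R * m.+1%:R * ln 4 + m%:R * ln 2 + ln q%:R + m%:R * ln 4).
move=> n n_gt1 le_qn; have n_gt0 := ltnW n_gt1.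
have r_gt0 := num_dperm_full_gt0 n_gt1.
have [|N [/andP[N_gt0 le_Nn] le_K le_n]] := @antichains_ub_nat m n q m_gt0.
  by rewrite q_gt0.
rewrite (card_antichains_dperm _ P_anti cardP).
move=> le_r; have := @ler_ln_nat R _ _ _ le_r.
rewrite !muln_gt0 expn_gt0 fact_gt0 N_gt0 r_gt0 => /(_ isT).
rewrite !lnM_nat ?muln_gt0 ?expn_gt0 ?muln_gt0 ?fact_gt0 ?r_gt0 ?N_gt0 ?n_gt0 //.
rewrite !lnX_nat ?muln_gt0 // lnM_nat //.
have := @ler_ln_nat R _ _ n_gt0 le_n.
rewrite lnM_nat ?expn_gt0 ?muln_gt0 ?N_gt0 // lnX_nat ?muln_gt0 // lnM_nat //.
have := ln_fact_ge R n_gt0.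
have := @ler_ln_nat R _ _ N_gt0 le_Nn.
have := @ler_ln_nat R 1 N isT N_gt0; rewrite ln1.
move: le_K; rewrite -(ler_nat R) !natrM !natrX -ler_pdivlMl ?ltr0n //.
rewrite -![m.+1%:R]natr1 ?[(m.+1 * _)%:R]natrM.
have q'_gt0 : 0 < q%:R^-1 :> R by rewrite invr_gt0 ltr0n.
move: (ln n`!%:R) (ln N%:R) (ln (num_dperm_full P n)%:R) (ln n%:R) => f l r x.
move: (ln (4 : R)) (ln (2 : R)) (ln (q%:R : R)) (_ ^+ m : R) => c4 c2 cq K.
have : 0 <= n%:R :> R by [].
have : 0 <= m%:R :> R by [].
have : 0 <= 2 ^+ m :> R by rewrite exprn_ge0.
move: (n%:R : R) (m%:R : R) (2 ^+ m : R) (q%:R^-1 : R) q'_gt0 => y u e v.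
move=> /ltW v_ge0 e_ge0 u_ge0 y_ge0 K_le l_ge0 l_le f_ge x_le r_le.
have uu_ge0 : 0 <= u * (u + 1) by rewrite mulr_ge0 ?addr_ge0.
(* The claim is the sum of the following five estimates. *)
have h1 : 0 <= u * (f - (y * x - y * c4)).
  by apply: mulr_ge0; rewrite ?subr_ge0.
have h2 : 0 <= y * (u * (c2 + l) + cq - x).
  by apply: mulr_ge0; rewrite ?subr_ge0.
have h3 : 0 <= u * ((u + 1) * K * l + (u + 1) * y * (c4 + x) - (f + r + y * l)).
  by apply: mulr_ge0; rewrite ?subr_ge0.
have h4 : 0 <= u * (u + 1) * l * (v * (e * y) - K).
  by apply: mulr_ge0; [exact: mulr_ge0|rewrite subr_ge0].
have h5 : 0 <= u * (u + 1) * (v * (e * y)) * (x - l).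
  by rewrite mulr_ge0 ?subr_ge0 // mulr_ge0 // mulr_ge0 // mulr_ge0.
by lra.
Qed.

(** First [q] is chosen to make the error of leading order at most half of [e],
    then [n] to absorb the linear terms. *)
Lemma ln_num_dperm_full_near (e : R) : 0 < e -> \forall n \near \oo,
  `|m%:R * ln (num_dperm_full P n)%:R - (m%:R ^+ 2 - 1) * (n%:R * ln n%:R)|
    <= e * (n%:R * ln (n%:R : R)).
Proof.
move=> e_gt0; have [B1 lb] := ln_num_dperm_full_ge.
pose D : R := m%:R * m.+1%:R * 2 ^+ m.
have D_ge0 : 0 <= D by rewrite !mulr_ge0.
pose q := (Num.bound (2 * D / e)).+1.
have le_q : D / q%:R <= e / 2.
  rewrite ler_pdivrMr ?ltr0n // -ler_pdivrMl ?divr_gt0 // invf_div.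
  have : 2 * D / e <= q%:R.
    apply/ltW/(lt_trans (archi_boundP _)); rewrite ?ltr_nat //.
    by rewrite !mulr_ge0 // invr_ge0 ltW.
  by rewrite mulrAC.
have [B2 ub] := @ln_num_dperm_full_le q isT.
near=> n.
have n_gt1 : (1 < n)%N by near: n; exact: nbhs_infty_gt.
have le_qn : (q <= n)%N by near: n; exact: nbhs_infty_ge.
have ge_ln (M : R) : expR M <= n%:R -> M <= ln n%:R.
  by move=> le_M; rewrite -[M]expRK ler_ln // posrE ?expR_gt0 // ltr0n ltnW.
have ln1 : B1 / e <= ln n%:R.
  by apply: ge_ln; near: n; exact: nbhs_infty_ger.
have ln2 : B2 / (e / 2) <= ln n%:R.
  by apply: ge_ln; near: n; exact: nbhs_infty_ger.
rewrite ler_pdivrMr // in ln1; rewrite ler_pdivrMr ?divr_gt0 // in ln2.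
have := lb n n_gt1; have := ub n n_gt1 le_qn.
rewrite ler_norml -/D.
have : 0 <= n%:R :> R by [].
have : 0 <= ln n%:R :> R by rewrite ln_ge0 // ler1n ltnW.
move: (n%:R : R) (ln (n%:R : R)) (ln (num_dperm_full P n)%:R) ln1 ln2.
move=> y x r ln1 ln2 x_ge0 y_ge0.
move: (D / _) le_q => v le_v le_r ge_r.
have h1 : 0 <= y * (x * e - B1) by rewrite mulr_ge0 ?subr_ge0.
have h2 : 0 <= y * (x * (e / 2) - B2) by rewrite mulr_ge0 ?subr_ge0.
have h3 : 0 <= (y * x) * (e / 2 - v) by rewrite mulr_ge0 ?subr_ge0 ?mulr_ge0.
by apply/andP; split; lra.
Unshelve. all: by end_near.
Qed.

End Estimates.

Lemma num_dperm_full_dim2 (n : nat) (P : SMP 2) :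
  plus_antipodal P -> #|P| = 2%N -> (1 < n)%N -> num_dperm_full P n = 1%N.
Proof.
move=> P_anti cardP n_gt1; apply/eqP; rewrite eqn_leq num_dperm_full_gt0 //.
rewrite -(leq_pmul2l (fact_gt0 n)) -(card_antichains_dperm _ P_anti cardP) muln1.
by rewrite card_antichains_dim2.
Qed.

Theorem theorem12 (R : realType) (d : nat) (hd : (2 <= d)%N) (P : SMP d)
    (hP : plus_antipodal P) (hcard : #|P| = 2%N) :
  exists eps : nat -> R,
    (eps n @[n --> \oo] --> (0 : R)) /\
    (\forall n \near \oo,
      ln ((num_dperm_full P n)%:R : R) =
        ((d%:R - 1) ^+ 2 - 1) / (d%:R - 1) * (n%:R * ln n%:R) * (1 + eps n)).
Proof.
case: d hd P hP hcard => [//|m]; rewrite ltnS => m_gt0 P P_anti cardP.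
rewrite -[m.+1%:R]natr1 addrK.
case: m m_gt0 P P_anti cardP => [//|[|m]] m_gt0 P P_anti cardP.
  exists (fun=> 0); split; first exact: cvg_cst.
  near=> n; rewrite num_dperm_full_dim2 //; last by near: n; exact: nbhs_infty_gt.
  by rewrite ln1 expr1n subrr !mul0r.
set u : R := m.+2%:R; have u_gt0 : 0 < u by rewrite ltr0n.
set c := (u ^+ 2 - 1) / u.
have u2_gt0 : 0 < u ^+ 2 - 1 by rewrite subr_gt0 exprn_egt1 // ltr1n.
have c_gt0 : 0 < c by rewrite divr_gt0.
have main_gt0 n : (1 < n)%N -> 0 < n%:R * ln (n%:R : R).
  by move=> n_gt1; rewrite mulr_gt0 ?ltr0n ?ln_gt0 ?ltr1n // ltnW.
have ratioE (v r x : R) : x != 0 -> v != 0 -> v ^+ 2 - 1 != 0 ->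
    r / ((v ^+ 2 - 1) / v * x) - 1 =
    (v * r - (v ^+ 2 - 1) * x) / ((v ^+ 2 - 1) * x).
  by move=> x_neq0 v_neq0 v2_neq0; field; rewrite x_neq0 v2_neq0.
exists (fun n => ln (num_dperm_full P n)%:R / (c * (n%:R * ln n%:R)) - 1); split.
  apply/cvgr0Pnorm_le => e e_gt0; near=> n.
  have n_gt1 : (1 < n)%N by near: n; exact: nbhs_infty_gt.
  have x_gt0 := main_gt0 _ n_gt1.
  have : `|u * ln (num_dperm_full P n)%:R - (u ^+ 2 - 1) * (n%:R * ln n%:R)|
      <= e * (u ^+ 2 - 1) * (n%:R * ln (n%:R : R)).
    by near: n; apply: ln_num_dperm_full_near => //; exact: mulr_gt0.
  move: (n%:R * ln (n%:R : R)) (ln (num_dperm_full P n)%:R : R) x_gt0 => x r x_gt0.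
  rewrite /c ratioE ?gt_eqF //.
  rewrite normrM normfV (gtr0_norm (mulr_gt0 u2_gt0 x_gt0)).
  by rewrite ler_pdivrMr ?mulr_gt0 // mulrA.
near=> n; have n_gt1 : (1 < n)%N by near: n; exact: nbhs_infty_gt.
have x_gt0 := main_gt0 _ n_gt1.
by rewrite addrCA subrr addr0 mulrCA mulfV ?mulr1 // gt_eqF // mulr_gt0.
Unshelve. all: by end_near.
Qed.
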